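(* Let $\mathbf K$ be $\mathbf H$ or $\mathbf O$. Each fractional $\mathbf R$-linear pseudoconformal mapping $f$ transforms each two points $z_1$ and $z_2$ symmetrical relative to a hypersphere $S$ in $\mathbf K$ into two points $w_1=f(z_1)$ and $w_2=f(z_2)$ symmetrical relative to the image hypersphere $f(S)$.
   Context: Let $\hat{\mathbf K}=\mathbf K\cup\{\infty\}$ be the one-point compactification. $\tilde z$ is the conjugate of $z\in\mathbf K$, $|z|^2=z\tilde z$. Each $z\in\mathbf K$ is written $z=|z|\exp(\mathrm{Arg}(z))$ with $\mathrm{Arg}(z)\in\mathbf K$, $\mathrm{Re}(\mathrm{Arg}(z))=0$. Two points $z_1,z_2$ are called symmetrical relative to a hypersphere $S$ with centre $z_0$ and radius $R>0$ in $\mathbf K$ if (i) $|z_1-z_0||z_2-z_0|=R^2$ and (ii) $\mathrm{Arg}(z_2-z_0)=\mathrm{Arg}(z_1-z_0)$. A hypersphere in $\hat{\mathbf K}$ is a set given by $Ez\tilde z+J\tilde z+z\tilde J+D=0$ with $E,D\in\mathbf R$, $J\in\mathbf K$ (for $E=0$ a real hyperplane, regarded as a hypersphere of infinite radius, for which symmetry is the Euclidean mirror reflection). A fractional $\mathbf R$-linear pseudoconformal mapping $\hat{\mathbf K}\to\hat{\mathbf K}$ is a composition of mappings of the following types: (i) $z\mapsto z+c$ for a fixed $c\in\mathbf K$; (ii) $z\mapsto z^{-1}$; (iii) if $\mathbf K=\mathbf H$: $z\mapsto azb$ for fixed $a,b\in\mathbf H$ with $ab\ne0$; if $\mathbf K=\mathbf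 O$: $z\mapsto Yz$, where $Y$ is an ordered product of operators $Y_{k,m}$, $0\le k<m\le7$, given by $Y_{k,m}h=h+(-1+\cos t_{k,m})(h_ki_k+h_mi_m)+\sin(t_{k,m})(h_mi_k-h_ki_m)$ for $h=h_0i_0+\dots+h_7i_7\in\mathbf O$, $h_j\in\mathbf R$, with parameters $t_{k,m}\in\mathbf R$, where $i_0=1,i_1,\dots,i_7$ are the standard generators. *)

(* Defs.v *)
(* MathComp-Analysis world. *)
From HB Require Import structures.
From mathcomp Require Import all_boot all_order all_algebra.
From mathcomp Require Import all_classical all_reals all_analysis.

Set Implicit Arguments.
Unset Strict Implicit.
Unset Printing Implicit Defensive.

Import Order.TTheory GRing.Theory Num.Theory.
Import numFieldNormedType.Exports.

Local Open Scope classical_set_scope.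
Local Open Scope ring_scope.

(* The Cayley-Dickson algebra of dimension 2 ^ r over R: R, C, H, O for
   r = 0, 1, 2, 3.  It carries the product topology; the library norm of a
   product is a sup norm, so that |z| is [cdabs z] below and not [`|z|]. *)
Fixpoint CD (R : realType) (r : nat) : normedModType R :=
  if r is r'.+1 then (CD R r' * CD R r')%type else R^o.

Notation quaternion R := (CD R 2).
Notation octonion R := (CD R 3).

Fixpoint cdconj (R : realType) (r : nat) : CD R r -> CD R r :=
  if r is r'.+1 return CD R r -> CD R r
  then fun z => (cdconj z.1, - z.2) else fun z => z.

(* (a, b) stands for a + b l, where l is the doubling generator. *)
Fixpoint cdmul (R : realType) (r : nat) : CD R r -> CD R r -> CD R r :=
  if r is r'.+1 return CD R r -> CD R r -> CD R r
  then fun z w => (cdmul z.1 w.1 - cdmul (cdconj w.2) z.2,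
                   cdmul w.2 z.1 + cdmul z.2 (cdconj w.1))
  else fun z w => (z : R) * (w : R).

(* The standard generators i_0 = 1, i_1, ..., i_(2 ^ r - 1). *)
Fixpoint cdgen (R : realType) (r : nat) (j : nat) : CD R r :=
  if r is r'.+1 return CD R r
  then if (j < 2 ^ r')%N then (cdgen R r' j, 0)
       else (0, cdgen R r' (j - 2 ^ r'))
  else (1 : R).

Fixpoint cdcoord (R : realType) (r : nat) (j : nat) : CD R r -> R :=
  if r is r'.+1 return CD R r -> R
  then fun z =>
    if (j < 2 ^ r')%N then cdcoord j z.1 else cdcoord (j - 2 ^ r')%N z.2
  else fun z => z.

Definition cd1 (R : realType) (r : nat) : CD R r := cdgen R r 0.
Definition cdRe (R : realType) (r : nat) (z : CD R r) : R := cdcoord 0 z.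
Definition cdabs (R : realType) (r : nat) (z : CD R r) : R :=
  Num.sqrt (cdRe (cdmul z (cdconj z))).

(* Equal to 0 at z = 0. *)
Definition cdinv (R : realType) (r : nat) (z : CD R r) : CD R r :=
  (cdabs z ^+ 2)^-1 *: cdconj z.

Definition cdpow (R : realType) (r : nat) (z : CD R r) (n : nat) : CD R r :=
  iter n (cdmul z) (cd1 R r).

Definition cdexp (R : realType) (r : nat) (z : CD R r) : CD R r :=
  lim (series (fun n => (n`!%:R : R)^-1 *: cdpow z n) @ \oo).

(* All the values of the multivalued argument, so that the equality of
   arguments does not depend on the choice of a branch. *)
Definition Arg (R : realType) (r : nat) (z : CD R r) : set (CD R r) :=
  [set M | cdRe M = 0 /\ z = cdabs z *: cdexp M].

(* None is the point at infinity. *)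
Notation CDhat R r := (one_point_compactification (CD R r)).

(* The zero set of E z z~ + J z~ + z J~ + D; it contains infinity when it is a
   hyperplane. *)
Definition hypersphere_set (R : realType) (r : nat) (E : R) (J : CD R r)
    (D : R) : set (CDhat R r) :=
  [set x | if x is Some z then
             E *: cdmul z (cdconj z) + cdmul J (cdconj z) + cdmul z (cdconj J)
             + D *: cd1 R r = 0
           else E = 0].

(* The strict inequality excludes the empty set, the points and the whole
   space: for E != 0 the squared radius is (|J|^2 - E D) / E^2, and for E = 0
   it says that J != 0. *)
Definition hypersphere (R : realType) (r : nat) (S : set (CDhat R r)) : Prop :=
  exists (E : R) (J : CD R r) (D : R),
    E * D < cdabs J ^+ 2 /\ S = hypersphere_set E J D.

Definition sphere_set (R : realType) (r : nat) (z0 : CD R r) (rho : R) :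
    set (CDhat R r) :=
  [set x | if x is Some z then cdabs (z - z0) = rho else False].

(* The centre and infinity are symmetrical to each other. *)
Definition sphere_sym (R : realType) (r : nat) (z0 : CD R r) (rho : R)
    (x1 x2 : CDhat R r) : Prop :=
  match x1, x2 with
  | Some z1, Some z2 =>
      cdabs (z1 - z0) * cdabs (z2 - z0) = rho ^+ 2 /\
      Arg (z2 - z0) = Arg (z1 - z0)
  | Some z, None | None, Some z => z = z0
  | None, None => False
  end.

(* Mirror reflection in the hyperplane J z~ + z J~ + D = 0, that is
   2 <J, z> + D = 0 with normal vector J: the segment [z1, z2] is normal to the
   hyperplane, which contains its midpoint.  Infinity is fixed. *)
Definition hyperplane_sym (R : realType) (r : nat) (J : CD R r) (D : R)
    (x1 x2 : CDhat R r) : Prop :=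
  match x1, x2 with
  | Some z1, Some z2 =>
      (exists t : R, z2 - z1 = t *: J) /\
      hypersphere_set 0 J D (Some (2^-1 *: (z1 + z2)))
  | None, None => True
  | _, _ => False
  end.

Definition symmetrical (R : realType) (r : nat) (S : set (CDhat R r))
    (x1 x2 : CDhat R r) : Prop :=
  (exists (z0 : CD R r) (rho : R),
     [/\ 0 < rho, S = sphere_set z0 rho & sphere_sym z0 rho x1 x2]) \/
  (exists (J : CD R r) (D : R),
     [/\ J != 0, S = hypersphere_set 0 J D & hyperplane_sym J D x1 x2]).

Definition fix_infty (R : realType) (r : nat) (g : CD R r -> CD R r)
    (x : CDhat R r) : CDhat R r :=
  if x is Some z then Some (g z) else None.

Definition inversion (R : realType) (r : nat) (x : CDhat R r) : CDhat R r :=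
  if x is Some z then (if z == 0 then None else Some (cdinv z)) else Some 0.

(* The operator Y_{k,m} with parameter t. *)
Definition oct_rot (R : realType) (k m : 'I_8) (t : R) (h : octonion R) :
    octonion R :=
  h + (-1 + cos t) *: (cdcoord k h *: cdgen R 3 k + cdcoord m h *: cdgen R 3 m)
    + sin t *: (cdcoord m h *: cdgen R 3 k - cdcoord k h *: cdgen R 3 m).

(* A product, in the order of the list, of operators Y_{k,m}; an entry
   (k, m, t) gives the indices and the parameter of a factor. *)
Definition oct_rots (R : realType) (s : seq ('I_8 * 'I_8 * R)) :
    octonion R -> octonion R :=
  foldr (fun p g => oct_rot p.1.1 p.1.2 p.2 \o g) id s.

Inductive pseudoconformal (R : realType) :
    forall r : nat, (CDhat R r -> CDhat R r) -> Prop :=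
| pc_shift (r : nat) (c : CD R r) :
    pseudoconformal (fix_infty (fun z : CD R r => z + c))
| pc_inversion (r : nat) : pseudoconformal (@inversion R r)
| pc_mul (a b : quaternion R) : cdmul a b != 0 ->
    pseudoconformal (fix_infty (fun z => cdmul (cdmul a z) b))
| pc_rot (s : seq ('I_8 * 'I_8 * R)) :
    all (fun p : 'I_8 * 'I_8 * R => (p.1.1 < p.1.2)%N) s ->
    pseudoconformal (fix_infty (oct_rots s))
| pc_comp (r : nat) (f g : CDhat R r -> CDhat R r) :
    pseudoconformal f -> pseudoconformal g -> pseudoconformal (f \o g).

(* Main.v *)
Require Import Defs.
From mathcomp Require Import all_boot all_order all_algebra.
From mathcomp Require Import all_classical all_reals all_analysis.
From mathcomp Require Import ring lra.
Import Order.TTheory GRing.Theory Num.Theory.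
Import numFieldNormedType.Exports.
Local Open Scope classical_set_scope.
Local Open Scope ring_scope.

(** Symmetry relative to a hypersphere is a hyperplane reflection in the
    projective (Lorentz) model of conformal geometry, where spheres, hyperplanes
    and the point at infinity need no separate treatment.

    Let <z, w> = Re (z w~) be the Euclidean inner product of the Cayley-Dickson
    algebra, and put on triples (v, a, b), with v in the algebra and a, b real,
    the form B((v, a, b), (v', a', b')) = 2 <v, v'> - a b' - a' b, of Lorentz
    signature.  A finite point z is represented by the isotropic vector
    (z, 1, |z|^2), and infinity by (0, 0, 1).  The hypersphere
    E z z~ + J z~ + z J~ + D = 0 is then the set of the points whose
    representative is B-orthogonal to s = (J, - E, - D), and its
    non-degeneracy E D < |J|^2 says that B(s, s) > 0 ([hypersphere_setE],
    [hypersphereP]).  Two points are symmetrical relative to it exactly when the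
    reflection X |-> X - 2 B(s, X) / B(s, s) s carries the representative of one
    to a nonzero multiple of the representative of the other ([symmetricalP]).

    Every generator of the pseudoconformal mappings is induced by a linear
    similarity of B: a translation by a unipotent map, the inversion by
    (v, a, b) |-> (v~, b, a), and the Euclidean similarities z |-> a z b and
    z |-> Y z by their action on v, with a rescaled b
    ([pseudoconformal_lorentz]).  A linear similarity A carries the reflection
    along s to the reflection along A s, which is the theorem
    ([lorentz_map_sphere]).

    The one analytic point is the equality of arguments in the definition of
    symmetry.  It determines the direction of a nonzero vector only if such a
    vector has an argument at all; this holds since
    exp (t n) = cos t + n sin t for an imaginary unit n ([cdexp_imag],
    [eq_Arg]). *)

(** * The Euclidean structure of the Cayley-Dickson algebras *)

(** The value Re (z w~), see [cdRe_mulconj], in a form in which symmetry,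
    bilinearity and positivity pass through the doubling. *)
Fixpoint cddot {R : realType} (r : nat) : CD R r -> CD R r -> R :=
  if r is r'.+1 return CD R r -> CD R r -> R
  then fun z w => cddot r' z.1 w.1 + cddot r' z.2 w.2
  else fun z w => (z : R) * (w : R).
Arguments cddot {R r}.

Section CayleyDickson.
Context {R : realType}.

Lemma cdconjD r (z w : CD R r) : cdconj (z + w) = cdconj z + cdconj w.
Proof.
elim: r z w => [|r IH] //= z w.
by congr (_, _); [exact: IH | exact: opprD].
Qed.

Lemma cdconjZ r (a : R) (z : CD R r) : cdconj (a *: z) = a *: cdconj z.
Proof.
elim: r z => [|r IH] //= z.
by congr (_, _); [exact: IH | rewrite scalerN].
Qed.

Lemma cdconjN r (z : CD R r) : cdconj (- z) = - cdconj z.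
Proof. by rewrite -scaleN1r cdconjZ scaleN1r. Qed.

Lemma cdconjK r (z : CD R r) : cdconj (cdconj z) = z.
Proof. by elim: r z => [|r IH] //= [a b] /=; rewrite IH opprK. Qed.

(** Both sides are proved together, since each component of a product in the
    double has the doubled factors once on the left and once on the right. *)
Lemma cdmulDZ r (a : R) (x y : CD R r) :
  (forall z, cdmul (a *: x + y) z = a *: cdmul x z + cdmul y z) /\
  (forall z, cdmul z (a *: x + y) = a *: cdmul z x + cdmul z y).
Proof.
elim: r x y => [|r IH] x y; split => z /=.
- by rewrite mulrDl -mulrA.
- by rewrite mulrDr /GRing.scale /= mulrCA.
- apply/pair_equal_spec; split => /=.
    rewrite (IH _ _).1 (IH _ _).2 scalerBr.
    by rewrite -!addrA; congr (_ + _); rewrite opprD addrCA.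
  by rewrite (IH _ _).1 (IH _ _).2 scalerDr addrACA.
- apply/pair_equal_spec; split => /=.
    rewrite (IH _ _).2 cdconjD cdconjZ (IH _ _).1 scalerBr.
    by rewrite -!addrA; congr (_ + _); rewrite opprD addrCA.
  by rewrite cdconjD cdconjZ (IH _ _).1 (IH _ _).2 scalerDr addrACA.
Qed.

Lemma cdmul0r r (z : CD R r) : cdmul 0 z = 0.
Proof.
by have := (cdmulDZ r (-1) 0 0).1 z; rewrite scaler0 add0r scaleN1r addNr.
Qed.
Lemma cdmulr0 r (z : CD R r) : cdmul z 0 = 0.
Proof.
by have := (cdmulDZ r (-1) 0 0).2 z; rewrite scaler0 add0r scaleN1r addNr.
Qed.
Lemma cdmulDl r (x y z : CD R r) : cdmul (x + y) z = cdmul x z + cdmul y z.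
Proof. by rewrite -[x in LHS]scale1r (cdmulDZ _ _ _ _).1 scale1r. Qed.
Lemma cdmulDr r (x y z : CD R r) : cdmul z (x + y) = cdmul z x + cdmul z y.
Proof. by rewrite -[x in LHS]scale1r (cdmulDZ _ _ _ _).2 scale1r. Qed.
Lemma cdmulZl r (a : R) (x z : CD R r) : cdmul (a *: x) z = a *: cdmul x z.
Proof. by rewrite -[_ *: x]addr0 (cdmulDZ _ _ _ _).1 cdmul0r addr0. Qed.
Lemma cdmulZr r (a : R) (x z : CD R r) : cdmul z (a *: x) = a *: cdmul z x.
Proof. by rewrite -[_ *: x]addr0 (cdmulDZ _ _ _ _).2 cdmulr0 addr0. Qed.
Lemma cdmulNl r (x z : CD R r) : cdmul (- x) z = - cdmul x z.
Proof. by rewrite -scaleN1r cdmulZl scaleN1r. Qed.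
Lemma cdmulNr r (x z : CD R r) : cdmul z (- x) = - cdmul z x.
Proof. by rewrite -scaleN1r cdmulZr scaleN1r. Qed.

Lemma cdconjM r (z w : CD R r) :
  cdconj (cdmul z w) = cdmul (cdconj w) (cdconj z).
Proof.
elim: r z w => [|r IH] z w /=; first exact: mulrC.
apply/pair_equal_spec; split => /=.
  by rewrite cdconjD cdconjN !IH cdconjK cdconjN cdmulNl cdmulNr opprK.
by rewrite cdconjK !cdmulNl opprD addrC.
Qed.

Lemma cdcoordDZ r j (a : R) (z w : CD R r) :
  cdcoord j (a *: z + w) = a * cdcoord j z + cdcoord j w.
Proof.
by elim: r j z w => [|r IH] j z w //=; case: ifP => _; apply: IH.
Qed.

Lemma cd1E r : cd1 R r.+1 = (cd1 R r, 0).
Proof. by rewrite /cd1 /= expn_gt0. Qed.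

Lemma cdReE r (z : CD R r.+1) : cdRe z = cdRe z.1.
Proof. by rewrite /cdRe /= expn_gt0. Qed.

Lemma cdRe1 r : cdRe (cd1 R r) = 1.
Proof. by elim: r => [|r IH] //; rewrite cdReE cd1E. Qed.

Lemma cdconj1 r : cdconj (cd1 R r) = cd1 R r.
Proof. by elim: r => [|r IH] //; rewrite cd1E /= IH oppr0. Qed.

Lemma cdconj0 r : cdconj (0 : CD R r) = 0.
Proof. by rewrite -[X in cdconj X](scale0r 0) cdconjZ scale0r. Qed.

Lemma cdmulr1 r (z : CD R r) : cdmul z (cd1 R r) = z.
Proof.
elim: r z => [|r IH] z; first exact: mulr1.
rewrite cd1E /= cdconj1 !IH cdconj0 !cdmul0r subr0 add0r.
by case: z.
Qed.

Lemma cdmul1r r (z : CD R r) : cdmul (cd1 R r) z = z.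
Proof. by rewrite -[LHS]cdconjK cdconjM cdconj1 cdmulr1 cdconjK. Qed.

Lemma cdDconj r (z : CD R r) : z + cdconj z = (2 * cdRe z) *: cd1 R r.
Proof.
elim: r z => [|r IH] z.
  by change ((z : R) + z = (2 * z) * 1); ring.
rewrite cdReE cd1E; apply/pair_equal_spec; split => /=.
  exact: IH.
by rewrite subrr scaler0.
Qed.

Lemma cddotC r (z w : CD R r) : cddot z w = cddot w z.
Proof.
elim: r z w => [|r IH] z w /=; first exact: mulrC.
by rewrite !(IH z.1) (IH z.2).
Qed.

Lemma cddotDZl r (a : R) (x y z : CD R r) :
  cddot (a *: x + y) z = a * cddot x z + cddot y z.
Proof.
elim: r x y z => [|r IH] x y z /=; first by rewrite mulrDl -mulrA.
by rewrite !IH; ring.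
Qed.

Lemma cddot0l r (z : CD R r) : cddot 0 z = 0.
Proof. by have := cddotDZl r (-1) 0 0 z; rewrite scaler0 add0r; lra. Qed.
Lemma cddotDl r (x y z : CD R r) : cddot (x + y) z = cddot x z + cddot y z.
Proof. by have := cddotDZl r 1 x y z; rewrite scale1r mul1r. Qed.
Lemma cddotZl r a (x z : CD R r) : cddot (a *: x) z = a * cddot x z.
Proof. by have := cddotDZl r a x 0 z; rewrite !addr0 cddot0l addr0. Qed.
Lemma cddotNl r (x z : CD R r) : cddot (- x) z = - cddot x z.
Proof. by rewrite -scaleN1r cddotZl mulN1r. Qed.
Lemma cddotDr r (x y z : CD R r) : cddot z (x + y) = cddot z x + cddot z y.
Proof. by rewrite cddotC cddotDl !(cddotC _ z). Qed.
Lemma cddotZr r a (x z : CD R r) : cddot z (a *: x) = a * cddot z x.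
Proof. by rewrite cddotC cddotZl !(cddotC _ z). Qed.
Lemma cddotNr r (x z : CD R r) : cddot z (- x) = - cddot z x.
Proof. by rewrite cddotC cddotNl !(cddotC _ z). Qed.
Lemma cddot0r r (z : CD R r) : cddot z 0 = 0.
Proof. by rewrite cddotC cddot0l. Qed.
Definition cddotE := (cddotDl, cddotDr, cddotNl, cddotNr, cddotZl, cddotZr,
  cddot0l, cddot0r).

Lemma cddot_ge0 r (z : CD R r) : 0 <= cddot z z.
Proof.
elim: r z => [|r IH] z /=; first by rewrite -expr2 sqr_ge0.
by rewrite addr_ge0.
Qed.

Lemma cddot_eq0 r (z : CD R r) : (cddot z z == 0) = (z == 0).
Proof.
elim: r z => [|r IH] z /=; first by rewrite mulf_eq0 orbb.
by rewrite paddr_eq0 ?cddot_ge0// !IH -pair_eqE.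
Qed.

Lemma cddot_gt0 r (z : CD R r) : (0 < cddot z z) = (z != 0).
Proof. by rewrite lt0r cddot_eq0 cddot_ge0 andbT. Qed.

Lemma cddot_inj r (u v : CD R r) :
  (forall x, cddot u x = cddot v x) -> u = v.
Proof.
move=> uv; apply/eqP; rewrite -subr_eq0 -cddot_eq0.
by rewrite cddotDl cddotNl uv subrr.
Qed.

Lemma cddot_conj r (z w : CD R r) : cddot (cdconj z) (cdconj w) = cddot z w.
Proof. by elim: r z w => [|r IH] z w //=; rewrite IH cddotNl cddotNr opprK. Qed.

(** The second equality is what the induction needs for the first: the real
    part of a product in the double contains w~ z from the second components. *)
Lemma cdRe_mulconj r (z w : CD R r) :
  cdRe (cdmul z (cdconj w)) = cddot z w /\
  cdRe (cdmul (cdconj w) z) = cddot z w.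
Proof.
elim: r z w => [|r IH] z w; first by rewrite /cdRe /= mulrC.
rewrite !cdReE /= cdconjN cdmulNl cdmulNr !opprK.
have ReD (x y : CD R r) : cdRe (x + y) = cdRe x + cdRe y.
  by have := cdcoordDZ r 0 1 x y; rewrite scale1r mul1r.
by rewrite !ReD !(IH _ _).1 !(IH _ _).2 (cddotC _ w.2).
Qed.

Lemma cdabsE r (z : CD R r) : cdabs z = Num.sqrt (cddot z z).
Proof. by rewrite /cdabs (cdRe_mulconj _ _ _).1. Qed.

Lemma sqr_cdabs r (z : CD R r) : cdabs z ^+ 2 = cddot z z.
Proof. by rewrite cdabsE sqr_sqrtr ?cddot_ge0. Qed.

Lemma cdabs_gt0 r (z : CD R r) : (0 < cdabs z) = (z != 0).
Proof. by rewrite cdabsE sqrtr_gt0 cddot_gt0. Qed.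

(** The element z w~ plus its conjugate is twice its real part: this turns the
    equation of a hypersphere, stated in the algebra, into a real equation. *)
Lemma cdmul_conjD r (z w : CD R r) :
  cdmul z (cdconj w) + cdmul w (cdconj z) = (2 * cddot z w) *: cd1 R r.
Proof.
have := cdDconj r (cdmul z (cdconj w)); rewrite cdconjM cdconjK.
by rewrite (cdRe_mulconj _ _ _).1.
Qed.

Lemma cdmul_conj r (z : CD R r) : cdmul z (cdconj z) = cddot z z *: cd1 R r.
Proof.
have := cdmul_conjD r z z; rewrite -mulr2n -scaler_nat -scalerA => H.
by apply: (scalerI _ H); rewrite pnatr_eq0.
Qed.

Lemma cddot1 r (z : CD R r) : cddot z (cd1 R r) = cdRe z.
Proof. by rewrite -(cdRe_mulconj _ _ _).1 cdconj1 cdmulr1. Qed.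

Lemma cddot_gen r (h : CD R r) j :
  (j < 2 ^ r)%N -> cddot h (cdgen R r j) = cdcoord j h.
Proof.
elim: r h j => [|r IH] h j /=; first by rewrite mulr1.
rewrite expnS mul2n -addnn => hj; case: ltnP => jr /=.
  by rewrite IH// cddot0r addr0.
by rewrite IH ?cddot0r ?add0r// ltn_subLR.
Qed.

Lemma cdcoord_gen r j k : (j < 2 ^ r)%N -> (k < 2 ^ r)%N ->
  cdcoord j (cdgen R r k) = (j == k)%:R.
Proof.
have co0 s i : cdcoord i (0 : CD R s) = 0.
  by have := cdcoordDZ s i (-1) 0 0; rewrite scaler0 addr0 mulN1r addNr.
elim: r j k => [|r IH] j k; first by rewrite expn0 !ltnS !leqn0 => /eqP-> /eqP->.
rewrite /= expnS mul2n -addnn => hj hk.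
case: (ltnP j) => jr; case: (ltnP k) => kr /=.
- exact: IH.
- by rewrite co0 (ltn_eqF (leq_trans jr kr)).
- by rewrite co0 (gtn_eqF (leq_trans kr jr)).
- by rewrite IH ?ltn_subLR// -(eqn_add2r (2 ^ r)) !subnK.
Qed.

End CayleyDickson.

(** * The exponential and the argument *)

Section Exponential.
Context {R : realType}.

Lemma cdmul_imag r (n : CD R r) :
  cdRe n = 0 -> cdmul n n = - cddot n n *: cd1 R r.
Proof.
move=> n0; rewrite scaleNr -cdmul_conj -cdmulNr; congr (cdmul n _).
by apply/eqP; rewrite -addr_eq0 cdDconj n0 mulr0 scale0r.
Qed.

(** Since n n = - 1, the powers alternate between the real line and the line of
    n; the products that occur are those of multiples of 1 and n. *)
Lemma cdpow_imag r (n : CD R r) (t : R) : cdRe n = 0 -> cddot n n = 1 ->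
  forall k, cdpow (t *: n) k.*2 = ((-1) ^+ k * t ^+ k.*2) *: cd1 R r /\
    cdpow (t *: n) k.*2.+1 = ((-1) ^+ k * t ^+ k.*2.+1) *: n.
Proof.
move=> n0 n1.
have step k : cdpow (t *: n) k.+1 = cdmul (t *: n) (cdpow (t *: n) k) by [].
elim=> [|k [_ IH]].
  split; first by rewrite mulr1 scale1r.
  by rewrite step /cdpow /= cdmulr1 mul1r expr1.
have E : cdpow (t *: n) k.+1.*2 = ((-1) ^+ k.+1 * t ^+ k.+1.*2) *: cd1 R r.
  rewrite doubleS step IH cdmulZl cdmulZr cdmul_imag// n1 !scalerA.
  by congr (_ *: _); rewrite !exprS; ring.
split; first exact: E.
rewrite step E cdmulZl cdmulZr cdmulr1 !scalerA.
by congr (_ *: _); rewrite !exprS; ring.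
Qed.

(** The exponential series splits into the cosine series along 1 and the sine
    series along n. *)
Lemma cdexp_imag r (n : CD R r) (t : R) : cdRe n = 0 -> cddot n n = 1 ->
  cdexp (t *: n) = cos t *: cd1 R r + sin t *: n.
Proof.
move=> n0 n1; rewrite /cdexp.
rewrite (_ : series _ = (fun m => series (cos_coeff t) m *: cd1 R r
    + series (sin_coeff t) m *: n)); last first.
  apply/funext => m; rewrite /series /= !scaler_suml -big_split /=.
  apply: eq_bigr => i _; rewrite /cos_coeff /sin_coeff /=.
  rewrite -(odd_double_half i); move: (odd i) i./2 => [] k.
    rewrite add1n (cdpow_imag r n t n0 n1 k).2 /= odd_double doubleK.
    by rewrite !mul0r scale0r add0r scalerA mul1r mulrC.
  rewrite add0n (cdpow_imag r n t n0 n1 k).1 /= odd_double doubleK.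
  by rewrite !mul0r scale0r addr0 scalerA mul1r mulrC.
apply: norm_cvg_lim; apply: cvgD; apply: cvgZr_tmp; rewrite unlock.
  exact: is_cvg_series_cos_coeff.
exact: is_cvg_series_sin_coeff.
Qed.

Lemma cdRe_gen1 r : cdRe (cdgen R r.+1 (2 ^ r)) = 0.
Proof.
rewrite /cdRe cdcoord_gen ?expn_gt0// ?ltn_exp2l//.
by rewrite ltn_eqF// expn_gt0.
Qed.

Lemma cddot_gen1 r : cddot (cdgen R r.+1 (2 ^ r)) (cdgen R r.+1 (2 ^ r)) = 1.
Proof. by rewrite cddot_gen ?cdcoord_gen ?eqxx// ltn_exp2l. Qed.

(** Write u = c + v with c real and v imaginary, so that |v|^2 = 1 - c^2.  Then
    u = cos t + n sin t for t = acos c and n the direction of v; if v = 0 the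
    direction is arbitrary, which is where the dimension must exceed 1. *)
Lemma cdexp_surj r (u : CD R r.+1) : cddot u u = 1 ->
  exists2 M, cdRe M = 0 & cdexp M = u.
Proof.
move=> u1; pose c := cdRe u; pose v := u - c *: cd1 R r.+1.
have v0 : cdRe v = 0.
  by rewrite -cddot1 /v !cddotE !cddot1 cdRe1 mulr1 subrr.
have vv : cddot v v = 1 - c ^+ 2.
  rewrite /v !cddotE (cddotC _ _ u) !cddot1 cdRe1 u1 -/c; ring.
have c2 : c ^+ 2 <= 1 by rewrite -subr_ge0 -vv cddot_ge0.
have c1 : -1 <= c <= 1.
  by rewrite -ler_norml -(@ler_pXn2r _ 2)// ?nnegrE// expr1n real_normK ?num_real.
have [n [n0 n1 vE]] : exists n, [/\ cdRe n = 0, cddot n n = 1 &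
    v = Num.sqrt (1 - c ^+ 2) *: n].
  have [v_eq0|v_neq0] := eqVneq v 0.
    exists (cdgen R r.+1 (2 ^ r)); split; [exact: cdRe_gen1|exact: cddot_gen1|].
    by rewrite -vv v_eq0 cddot0l sqrtr0 scale0r.
  have s0 : Num.sqrt (1 - c ^+ 2) != 0.
    by rewrite gt_eqF// sqrtr_gt0 -vv cddot_gt0.
  exists ((Num.sqrt (1 - c ^+ 2))^-1 *: v); split.
  - by rewrite -cddot1 cddotZl cddot1 v0 mulr0.
  - rewrite cddotZl cddotZr mulrA -expr2 exprVn sqr_sqrtr ?subr_ge0// -vv mulVf//.
    by rewrite cddot_eq0.
  - by rewrite scalerA mulfV// scale1r.
exists (acos c *: n); first by rewrite -cddot1 cddotZl cddot1 n0 mulr0.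
rewrite cdexp_imag// sin_acos// acosK ?in_itv// -vE.
by rewrite /v addrC subrK.
Qed.

Lemma cdabsZ r (t : R) (z : CD R r) : 0 <= t -> cdabs (t *: z) = t * cdabs z.
Proof.
move=> t0; rewrite !cdabsE !cddotE mulrA -expr2 sqrtrM ?sqr_ge0// sqrtr_sqr.
by rewrite ger0_norm.
Qed.

Lemma Arg_scale r (t : R) (z : CD R r) : 0 < t -> Arg (t *: z) = Arg z.
Proof.
move=> t0; rewrite /Arg cdabsZ ?ltW//; apply/seteqP; split => M /= [M0 zM].
  by split => //; apply: (scalerI (lt0r_neq0 t0)); rewrite {1}zM scalerA.
by split => //; rewrite -scalerA -zM.
Qed.

(** Without it, two empty arguments would be equal and the condition on the
    arguments in the definition of symmetry would be void. *)
Lemma Arg_neq0 r (z : CD R r.+1) : z != 0 -> exists M, Arg z M.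
Proof.
move=> z0.
have a0 : cdabs z != 0 by rewrite gt_eqF// cdabs_gt0.
have [|M M0 eM] := cdexp_surj r ((cdabs z)^-1 *: z).
  by rewrite !cddotE mulrA -expr2 exprVn sqr_cdabs mulVf// cddot_eq0.
by exists M; split => //; rewrite eM scalerA mulfV// scale1r.
Qed.

(** A common value M of the arguments gives z / |z| = exp M = w / |w|. *)
Lemma eq_Arg r (z w : CD R r.+1) : z != 0 -> w != 0 ->
  Arg w = Arg z -> exists2 t : R, 0 < t & w = t *: z.
Proof.
move=> z0 w0 wz; have [M zM] := Arg_neq0 r z z0.
have [M0 wE] : Arg w M by rewrite wz.
exists (cdabs w / cdabs z); first by rewrite divr_gt0 ?cdabs_gt0.
have zE : cdexp M = (cdabs z)^-1 *: z.
  by rewrite [X in _ *: X]zM.2 scalerA mulVf ?scale1r// gt_eqF// cdabs_gt0.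
by rewrite -scalerA -zE.
Qed.

End Exponential.

(** * The Lorentz model of the hyperspheres *)

Definition lorentz (R : realType) (r : nat) : lmodType R :=
  (CD R r * R^o * R^o)%type.

Definition lvec {R : realType} {r : nat} (v : CD R r) (a b : R) : lorentz R r :=
  (v, a, b).

Section Lorentz.
Context {R : realType} {r : nat}.
Implicit Types (x y : CDhat R r) (z w v c : CD R r) (s X Y : lorentz R r).

(** The form B of the Lorentz model. *)
Definition lform X Y : R :=
  2 * cddot X.1.1 Y.1.1 - (X.1.2 : R) * Y.2 - (Y.1.2 : R) * X.2.

(** Isotropic for [lform]: the paraboloid model of the one-point
    compactification. *)
Definition nullvec x : lorentz R r :=
  if x is Some z then lvec z 1 (cddot z z) else lvec 0 0 1.

Lemma lvec_surj X : exists v a b, X = lvec v a b.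
Proof. by case: X => [[v a] b]; exists v, a, b. Qed.

Lemma lvecP v (a b : R) w (a' b' : R) :
  lvec v a b = lvec w a' b' <-> [/\ v = w, a = a' & b = b'].
Proof. by split=> [[-> -> ->]//|[-> -> ->]]. Qed.

Lemma lvecD v (a b : R) w (a' b' : R) :
  lvec v a b + lvec w a' b' = lvec (v + w) (a + a') (b + b').
Proof. by []. Qed.

Lemma lvecN v (a b : R) : - lvec v a b = lvec (- v) (- a) (- b).
Proof. by []. Qed.

Lemma lvecZ (k : R) v (a b : R) : k *: lvec v a b = lvec (k *: v) (k * a) (k * b).
Proof. by []. Qed.
Definition lvecE := (lvecZ, lvecN, lvecD).

Lemma lform_lvec v (a b : R) w (a' b' : R) :
  lform (lvec v a b) (lvec w a' b') = 2 * cddot v w - a * b' - a' * b.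
Proof. by []. Qed.

Lemma lformC X Y : lform X Y = lform Y X.
Proof. by rewrite /lform cddotC; ring. Qed.

Lemma lformZl (k : R) X s : lform (k *: X) s = k * lform X s.
Proof.
have [[v [a [b ->]]] [t [e [f ->]]]] := (lvec_surj X, lvec_surj s).
by rewrite lvecE !lform_lvec cddotZl; ring.
Qed.

Lemma lformZr (a : R) X s : lform s (a *: X) = a * lform s X.
Proof. by rewrite lformC lformZl !(lformC s). Qed.

Definition polar s : set (CDhat R r) := [set x | lform s (nullvec x) = 0].

(** The reflection along s of the representative of x, cleared of its
    denominator, is proportional to the representative of y. *)
Definition mirror s x y := exists2 k : R, k != 0 &
  k *: nullvec y = lform s s *: nullvec x - (2 * lform s (nullvec x)) *: s.

Lemma polarZ (a : R) s : a != 0 -> polar (a *: s) = polar s.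
Proof.
move=> a0; apply/seteqP; split => x; rewrite /polar /= lformZl => /eqP.
  by rewrite mulf_eq0 (negbTE a0) => /eqP.
by move=> /eqP ->; rewrite mulr0.
Qed.

Lemma mirrorZ (a : R) s x y : a != 0 -> mirror (a *: s) x y -> mirror s x y.
Proof.
move=> a0 [k k0 kE]; exists (k / a ^+ 2).
  by rewrite mulf_neq0// invr_eq0 sqrf_eq0.
rewrite [k / _]mulrC -(scalerA _ k) kE !lformZl lformZr scalerBr !scalerA.
by congr (_ *: _ - _ *: _); field.
Qed.

(** A linear equation on the paraboloid: at the point z it reads
    E |z|^2 + 2 <J, z> + D = 0, and at infinity E = 0. *)
Lemma hypersphere_setE E (J : CD R r) D :
  hypersphere_set E J D = polar (lvec J (- E) (- D)).
Proof.
rewrite /polar; apply/seteqP; split; case=> [z|]; rewrite /= lform_lvec ?cddot0r.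
all: rewrite ?cdmul_conj -?[_ + cdmul J _ + _]addrA ?cdmul_conjD.
all: rewrite ?scalerA -?scalerDl.
- move/eqP; rewrite scaler_eq0 -cddot_eq0 cddot1 cdRe1 oner_eq0 orbF => /eqP.
  lra.
- lra.
- by move=> H; apply/eqP; rewrite scaler_eq0; apply/orP; left; apply/eqP; lra.
- lra.
Qed.

Lemma hypersphereP (S : set (CDhat R r)) :
  hypersphere S <-> exists2 s, 0 < lform s s & S = polar s.
Proof.
split=> [[E [J [D [EDJ ->]]]]|[s + ->]].
  exists (lvec J (- E) (- D)); last exact: hypersphere_setE.
  by move: EDJ; rewrite sqr_cdabs lform_lvec; lra.
have [v [a [b ->]]] := lvec_surj s; rewrite lform_lvec => s0.
exists (- a), v, (- b); rewrite hypersphere_setE !opprK; split => //.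
by move: s0; rewrite sqr_cdabs; lra.
Qed.

(** The vector of the sphere with centre z and radius rho, normalised to
    have middle component 1.  The vectors of the hyperplanes are those with
    middle component 0. *)
Definition center_vec z (rho : R) : lorentz R r := lvec z 1 (cddot z z - rho ^+ 2).

Lemma lform_center_some z0 rho z :
  lform (center_vec z0 rho) (nullvec (Some z)) =
  rho ^+ 2 - cddot (z - z0) (z - z0).
Proof. by rewrite /center_vec /= lform_lvec !cddotE (cddotC _ z z0); ring. Qed.
Lemma lform_center_inf z0 rho :
  lform (center_vec z0 rho) (nullvec None) = -1.
Proof. by rewrite /center_vec /= lform_lvec !cddotE; ring. Qed.
Lemma lform_center z0 rho :
  lform (center_vec z0 rho) (center_vec z0 rho) = 2 * rho ^+ 2.
Proof. by rewrite /center_vec lform_lvec; ring. Qed.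

Lemma sphere_setE z rho : 0 < rho -> sphere_set z rho = polar (center_vec z rho).
Proof.
move=> rho0; rewrite /polar; apply/seteqP; split; case=> [w|] //.
- by rewrite /mkset lform_center_some => <-; rewrite sqr_cdabs subrr.
- rewrite /mkset lform_center_some => /eqP; rewrite subr_eq0 => /eqP H.
  by rewrite /sphere_set /= cdabsE -H sqrtr_sqr gtr0_norm.
- rewrite /mkset lform_center_inf; lra.
Qed.

(** The vector of a hyperplane is B-orthogonal to (0, 0, 1), so that infinity is
    fixed.  Its middle component vanishes, so that the middle components of the
    finite points are only multiplied by 2 |J|^2; the first ones then give the
    Euclidean reflection z |-> z - (2 <J, z> + D) / |J|^2 J. *)
Lemma mirror_hyperplane (J : CD R r) (D : R) x y : J != 0 ->
  mirror (lvec J 0 (- D)) x y <-> hyperplane_sym J D x y.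
Proof.
rewrite -cddot_gt0 => J0; have Jn0 := lt0r_neq0 J0.
rewrite /mirror lform_lvec.
case: x y => [z|] [w|]; rewrite /hyperplane_sym ?hypersphere_setE /polar /mkset /nullvec
  ?lform_lvec; split.
- case=> k k0; rewrite !lvecE => /lvecP[wE kE _].
  have {kE}kE : k = 2 * cddot J J by lra.
  have wz : w = z - ((2 * cddot J z + D) / cddot J J) *: J.
    apply: (scalerI k0); rewrite wE kE scalerBr scalerA.
    by congr (_ *: _ - _ *: _); [ring | field].
  split.
    exists (- ((2 * cddot J z + D) / cddot J J)).
    by rewrite wz scaleNr addrAC subrr add0r.
  by rewrite wz !cddotE; field.
- case=> -[t tE] H.
  have wE : w = z + t *: J by rewrite -tE addrC subrK.
  have {}H : 2 * cddot J z = - D - t * cddot J J.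
    by move: H; rewrite wE !cddotE; lra.
  exists (2 * cddot J J); first by rewrite mulf_neq0.
  rewrite !lvecE; apply/lvecP; rewrite wE; split.
  + rewrite scalerDr scalerA -(scaleNr _ J); congr (_ *: _ + _ *: _).
      by ring.
    by rewrite H; ring.
  + by ring.
  + have Jz : cddot J z = (- D - t * cddot J J) / 2 by lra.
    rewrite !cddotE (cddotC _ z J) Jz.
    by field.
- case=> k k0; rewrite !lvecE => /lvecP[_ H _].
  by exfalso; lra.
- by [].
- case=> k k0; rewrite !lvecE => /lvecP[_ H _].
  by exfalso; move/eqP: k0; apply; lra.
- by [].
- by [].
- move=> _; exists (2 * cddot J J); first by rewrite mulf_neq0.
  rewrite cddot0r !lvecE; apply/lvecP; split; try by ring.
  by rewrite !scaler0 !mulr0 !mul0r !subr0 mulr0 scale0r subr0.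
Qed.

End Lorentz.

Section Sphere.
Context {R : realType} {r : nat}.
Implicit Types (x y : CDhat R r.+1) (z w v c : CD R r.+1) (s X Y : lorentz R r.+1).

(** Comparing middle components gives the factor of proportionality
    2 |z - z0|^2; the first components then give
    w - z0 = rho^2 / |z - z0|^2 (z - z0), the classical inversion.  That
    factor vanishes when z is the centre, which is sent to infinity. *)
Lemma mirror_sphere z0 (rho : R) x y : 0 < rho ->
  mirror (center_vec z0 rho) x y <-> sphere_sym z0 rho x y.
Proof.
move=> rho0; have rho2 : rho ^+ 2 != 0 by rewrite expf_neq0 // gt_eqF.
rewrite /mirror lform_center.
case: x y => [z|] [w|]; rewrite ?lform_center_some ?lform_center_inf
  /sphere_sym /nullvec /center_vec ?lvecE.
- set d := cddot (z - z0) _; split.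
    case=> k k0; rewrite !lvecE => /lvecP[wE kE _].
    have {kE}kE : k = 2 * d by lra.
    have d0 : d != 0 by apply: contraNneq k0 => d0; rewrite kE d0 mulr0.
    have wz : w - z0 = (rho ^+ 2 / d) *: (z - z0).
      apply: (scalerI k0); rewrite scalerBr wE kE !scalerBr !scalerA.
      rewrite -addrA -opprD -scalerDl.
      by congr (_ *: _ - _ *: _); field.
    have t0 : 0 < rho ^+ 2 / d.
      by rewrite divr_gt0 ?exprn_gt0// lt0r d0 cddot_ge0.
    split; last by rewrite wz Arg_scale.
    by rewrite wz cdabsZ ?ltW// mulrCA -expr2 sqr_cdabs -/d mulfVK.
  case=> absE argE.
  have [zn0 wn0] : z - z0 != 0 /\ w - z0 != 0.
    by split; apply: contraTneq rho2 => H;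
      rewrite negbK -absE H !cdabsE cddot0l sqrtr0 ?mul0r ?mulr0.
  have [t t0 wz] := eq_Arg _ _ _ zn0 wn0 argE.
  have rhoE : rho ^+ 2 = t * d.
    by rewrite -absE wz cdabsZ ?ltW// mulrCA -expr2 sqr_cdabs.
  have wE : w = z0 + t *: (z - z0) by rewrite -wz addrC subrK.
  exists (2 * d); first by rewrite mulf_neq0// cddot_eq0.
  rewrite !lvecE; apply/lvecP; rewrite rhoE; split.
  + rewrite wE scalerDr scalerBr scalerBr !scalerA addrCA -!(scaleNr _ z0) -scalerDl.
    by congr (_ *: _ + _ *: _); ring.
  + by ring.
  + by rewrite wE /d !cddotE (cddotC _ z z0); ring.
- split.
    case=> k k0; rewrite !lvecE => /lvecP[_ H _].
    by apply/eqP; rewrite -subr_eq0 -cddot_eq0; apply/eqP; lra.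
  move=> ->; rewrite subrr cddot0l subr0.
  (* At the centre the reflected vector is 2 rho^4 (0, 0, 1). *)
  exists (2 * rho ^+ 4); first by rewrite mulf_neq0 // expf_neq0// gt_eqF.
  by rewrite !lvecE; apply/lvecP; split; rewrite ?scaler0 ?subrr//; ring.
- split.
    case=> k k0; rewrite !lvecE => /lvecP[H kE _].
    have {kE}kE : k = 2 by lra.
    apply: (scalerI k0); rewrite H kE scaler0 add0r -(scaleNr _ z0).
    by congr (_ *: _); ring.
  move=> ->; exists 2 => //.
  rewrite !lvecE; apply/lvecP; split;
    rewrite ?scaler0 ?add0r -?(scaleNr _ z0); try by ring.
  by congr (_ *: _); ring.
- by split=> // -[k k0]; rewrite !lvecE => /lvecP[_ H _]; lra.
Qed.

(** A vector s with B(s, s) > 0 is, up to a scalar, the vector of a sphere or,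
    if its middle component vanishes, of a hyperplane.  Symmetry relative to S
    is thus independent of the way in which S is given. *)
Lemma symmetricalP (S : set (CDhat R r.+1)) x y :
  symmetrical S x y <->
  exists s, [/\ 0 < lform s s, S = polar s & mirror s x y].
Proof.
split.
  case=> [[z0 [rho [rho0 -> H]]]|[J [D [J0 -> H]]]].
    exists (center_vec z0 rho); split; [|exact: sphere_setE|exact/mirror_sphere].
    by rewrite lform_center mulr_gt0// exprn_gt0.
  exists (lvec J 0 (- D)); split; last exact/mirror_hyperplane.
    by rewrite lform_lvec !mul0r !subr0 mulr_gt0// cddot_gt0.
  by rewrite hypersphere_setE oppr0.
case=> s; have [v [a [b ->]]] := lvec_surj s => -[s0 -> H].
have [a0|a0] := eqVneq a 0; [right|left].
  rewrite a0 in H s0 *; exists v, (- b).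
  have v0 : v != 0 by rewrite -cddot_gt0; move: s0; rewrite lform_lvec; lra.
  split => //; first by rewrite hypersphere_setE oppr0 opprK.
  by apply/mirror_hyperplane; rewrite // opprK.
move: s0; set q := lform _ _ => q0.
(* The vector of the sphere of radius rho has square 2 rho^2, and s is a times it. *)
pose rho := Num.sqrt (q / (2 * a ^+ 2)).
have a2 : 0 < 2 * a ^+ 2 by rewrite mulr_gt0// exprn_even_gt0.
have rho2 : rho ^+ 2 = q / (2 * a ^+ 2).
  by rewrite sqr_sqrtr// divr_ge0// ltW.
have sE : lvec v a b = a *: center_vec (a^-1 *: v) rho.
  rewrite /center_vec lvecE rho2 /q lform_lvec; apply/lvecP; split.
  - by rewrite scalerA mulfV// scale1r.
  - by rewrite mulr1.
  - by rewrite !cddotE; field.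
have rho0 : 0 < rho by rewrite sqrtr_gt0 divr_gt0.
exists (a^-1 *: v), rho; split => //.
  by rewrite sphere_setE// sE polarZ.
by apply/mirror_sphere => //; apply: (mirrorZ _ _ _ _ a0); rewrite -sE.
Qed.

End Sphere.

(** * Maps induced by similarities of the Lorentz form *)

Section LorentzMaps.
Context {R : realType} {r : nat}.
Implicit Types (x y : CDhat R r) (z w v c : CD R r) (s X Y : lorentz R r).

(** The multiplier m depends on the point because the representatives of the
    points are only defined up to a factor. *)
Definition lorentz_map (f : CDhat R r -> CDhat R r) : Prop :=
  (forall y, exists x, f x = y) /\
  exists (A : lorentz R r -> lorentz R r) (l : R),
    [/\ linear A, 0 < l, forall X Y, lform (A X) (A Y) = l * lform X Y &
        forall x, exists2 m : R, m != 0 & nullvec (f x) = m *: A (nullvec x)].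

Lemma lorentz_map_comp f g :
  lorentz_map f -> lorentz_map g -> lorentz_map (f \o g).
Proof.
move=> [fS [A [l [Alin l0 Al Af]]]] [gS [B [k [Blin k0 Bk Bg]]]]; split.
  by move=> y; have [x <-] := fS y; have [w <-] := gS x; exists w.
have AZ := GRing.scalable_linear Alin.
exists (A \o B), (l * k); split.
- by move=> a X Y /=; rewrite Blin Alin.
- exact: mulr_gt0.
- by move=> X Y; rewrite /= Al Bk mulrA.
- move=> x; have [m m0 mE] := Bg x; have [n n0 nE] := Af (g x).
  exists (n * m); first by rewrite mulf_neq0.
  by rewrite /= nE mE AZ scalerA.
Qed.

(** The new vector is the image of s: a similarity conjugates the reflection
    along s to the reflection along its image. *)
Lemma lorentz_map_sphere f s : lorentz_map f -> 0 < lform s s ->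
  exists s', [/\ 0 < lform s' s', f @` polar s = polar s' &
    forall x y, mirror s x y -> mirror s' (f x) (f y)].
Proof.
move=> [fS [A [l [Alin l0 Al Af]]]] s0; exists (A s); split.
- by rewrite Al mulr_gt0.
- apply/seteqP; split => y.
    case=> x xs <-; have [m m0 mE] := Af x.
    by rewrite /polar /mkset mE lformZr Al xs !mulr0.
  have [x <-] := fS y; have [m m0 mE] := Af x.
  rewrite /polar /mkset mE lformZr Al => /eqP.
  by rewrite !mulf_eq0 (negbTE m0) gt_eqF// => /eqP xs; exists x.
- move=> x y [k k0 kE]; have [m m0 mE] := Af x; have [n n0 nE] := Af y.
  have [AB AZ] := (GRing.zmod_morphism_linear Alin, GRing.scalable_linear Alin).
  exists (m * l * k / n); first by rewrite !mulf_neq0 ?invr_eq0// gt_eqF.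
  rewrite nE scalerA mulfVK// -scalerA -AZ kE AB !AZ mE Al lformZr Al.
  rewrite scalerBr !scalerA.
  by congr (_ *: _ - _ *: _); ring.
Qed.

Lemma fix_infty_surj (L : CD R r -> CD R r) : (forall w, exists z, L z = w) ->
  forall y, exists x, fix_infty L x = y.
Proof.
by move=> LS [w|]; [have [z <-] := LS w; exists (Some z) | exists None].
Qed.

(** The last component of a representative is a squared norm, and hence is
    multiplied by l; infinity is fixed, with multiplier 1 / l. *)
Lemma lorentz_map_similarity (L : CD R r -> CD R r) (l : R) : 0 < l ->
  linear L -> (forall w, exists z, L z = w) ->
  (forall z, cddot (L z) (L z) = l * cddot z z) -> lorentz_map (fix_infty L).
Proof.
move=> l0 Llin LS Ll; split; first exact: fix_infty_surj.
exists (fun X => lvec (L X.1.1) X.1.2 (l * X.2)), l; split => //.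
- move=> k X Y; have [v [a [b ->]]] := lvec_surj X.
  have [w [a' [b' ->]]] := lvec_surj Y.
  by rewrite !lvecE /= Llin; apply/lvecP; split => //; rewrite /GRing.scale /=; ring.
- move=> X Y; have [v [a [b ->]]] := lvec_surj X.
  have [w [a' [b' ->]]] := lvec_surj Y.
  have LD z t : cddot (L z) (L t) = l * cddot z t.
    have := Ll (z + t); have := Llin 1 z t; rewrite !scale1r => ->.
    by rewrite !cddotE !Ll (cddotC _ (L t)) (cddotC _ t); lra.
  by rewrite !lform_lvec /= LD; ring.
- have L0 : L 0 = 0.
    by have := GRing.zmod_morphism_linear Llin 0 0; rewrite !subrr.
  case=> [z|].
    by exists 1; rewrite ?oner_neq0// scale1r /fix_infty /nullvec /= Ll.
  exists l^-1; first by rewrite invr_eq0 gt_eqF.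
  by rewrite /fix_infty /nullvec /= L0 lvecZ scaler0 !mulr0 mulr1 mulVf// gt_eqF.
Qed.

(** From |z + c|^2 = |z|^2 + 2 <z, c> + |c|^2, made homogeneous by the middle
    component. *)
Lemma lorentz_map_shift c : lorentz_map (fix_infty (fun z => z + c)).
Proof.
split; first by apply: fix_infty_surj => w; exists (w - c); rewrite subrK.
exists (fun X => lvec (X.1.1 + (X.1.2 : R) *: c) X.1.2
  (X.2 + 2 * cddot X.1.1 c + (X.1.2 : R) * cddot c c)), 1; split => //.
- move=> k X Y; have [v [a [b ->]]] := lvec_surj X.
  have [w [a' [b' ->]]] := lvec_surj Y.
  rewrite !lvecE /=; apply/lvecP; split => //.
    by rewrite scalerDr scalerDl scalerA addrACA.
  by rewrite !cddotE /GRing.scale /=; ring.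
- move=> X Y; have [v [a [b ->]]] := lvec_surj X.
  have [w [a' [b' ->]]] := lvec_surj Y.
  by rewrite !lform_lvec /= !cddotE (cddotC _ c w); ring.
- case=> [z|]; exists 1; rewrite ?oner_neq0// scale1r /fix_infty /nullvec /=;
    apply/lvecP; split => //.
  + by rewrite scale1r.
  + by rewrite !cddotE (cddotC _ c z); ring.
  + by rewrite scale0r addr0.
  + by rewrite cddot0l; ring.
Qed.

(** The inverse z~ / |z|^2 is represented by (z~, |z|^2, 1), up to the factor
    1 / |z|^2: the inversion exchanges the last two components, and with them
    0 and infinity. *)
Lemma lorentz_map_inversion : lorentz_map (@inversion R r).
Proof.
have sqn0 z : z != 0 -> (cddot z z)^-1 != 0 by rewrite invr_eq0 cddot_eq0.
split.
  case=> [w|]; last by exists (Some 0); rewrite /inversion eqxx.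
  have [->|w0] := eqVneq w 0; first by exists None.
  exists (Some (cdinv w)); rewrite /inversion.
  have iw0 : cdinv w != 0.
    rewrite /cdinv -cddot_eq0 !cddotE cddot_conj sqr_cdabs.
    by rewrite !mulf_neq0 ?sqn0// cddot_eq0.
  rewrite (negbTE iw0); congr Some; rewrite /cdinv !sqr_cdabs.
  rewrite !cddotE cddot_conj cdconjZ cdconjK scalerA.
  rewrite (_ : _ * _ = 1) ?scale1r//; field.
  by rewrite cddot_eq0.
exists (fun X => lvec (cdconj X.1.1) X.2 X.1.2), 1; split => //.
- move=> k X Y; have [v [a [b ->]]] := lvec_surj X.
  have [w [a' [b' ->]]] := lvec_surj Y.
  by rewrite !lvecE /= cdconjD cdconjZ.
- move=> X Y; have [v [a [b ->]]] := lvec_surj X.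
  have [w [a' [b' ->]]] := lvec_surj Y.
  by rewrite !lform_lvec /= cddot_conj; ring.
- case=> [z|]; last first.
    by exists 1; rewrite ?oner_neq0// scale1r /= cdconj0 cddot0l.
  rewrite /inversion; have [->|z0] := eqVneq z 0.
    by exists 1; rewrite ?oner_neq0// scale1r /= cdconj0 cddot0l.
  exists ((cddot z z)^-1); first exact: sqn0.
  rewrite /= /cdinv sqr_cdabs lvecE; apply/lvecP; split => //.
    by rewrite mulVf// cddot_eq0.
  by rewrite !cddotE cddot_conj mulVf ?mulr1// cddot_eq0.
Qed.

End LorentzMaps.

(** * The generators of the pseudoconformal mappings *)

Section Generators.
Context {R : realType}.

(** The four-square identity of Euler. *)
Lemma quaternion_sqM (a z : quaternion R) :
  cddot (cdmul a z) (cdmul a z) = cddot a a * cddot z z.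
Proof.
case: a z => [[a1 a2] [a3 a4]] [[z1 z2] [z3 z4]].
by rewrite /= /GRing.scale /=; ring.
Qed.

Lemma quaternion_mulA (a b c : quaternion R) :
  cdmul a (cdmul b c) = cdmul (cdmul a b) c.
Proof.
case: a b c => [[a1 a2] [a3 a4]] [[b1 b2] [b3 b4]] [[c1 c2] [c3 c4]].
by congr (_, _, (_, _)); rewrite /=; ring.
Qed.

Lemma lorentz_map_mul (a b : quaternion R) : cdmul a b != 0 ->
  lorentz_map (fix_infty (fun z => cdmul (cdmul a z) b)).
Proof.
rewrite -cddot_gt0 quaternion_sqM => ab0.
have := lt0r_neq0 ab0; rewrite mulf_eq0 negb_or => /andP[an0 bn0].
apply: (lorentz_map_similarity _ _ ab0).
- by move=> k x y; rewrite cdmulDr cdmulZr cdmulDl cdmulZl.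
- move=> w; exists ((cddot a a * cddot b b)^-1 *:
    cdmul (cdmul (cdconj a) w) (cdconj b)).
  rewrite cdmulZr cdmulZl !quaternion_mulA cdmul_conj -!quaternion_mulA.
  have -> : cdmul (cdconj b) b = cddot b b *: cd1 R 2.
    by have := cdmul_conj 2 (cdconj b); rewrite cdconjK cddot_conj.
  rewrite cdmulZl cdmul1r !cdmulZr cdmulr1 !scalerA (_ : _ * _ = 1) ?scale1r//.
  by rewrite -mulrA mulVf// mulf_neq0.
- by move=> z; rewrite !quaternion_sqM; ring.
Qed.

End Generators.

Section PlaneRotation.
Context {R : realType} {r : nat}.
Implicit Types (e f h x y : CD R r).

(** The rotation of angle t in the plane of the orthonormal vectors e and f:
    the operators Y_{k,m} are the case of two generators. *)
Definition plane_rot e f (t : R) h : CD R r :=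
  h + ((cos t - 1) * cddot h e + sin t * cddot h f) *: e
    + ((cos t - 1) * cddot h f - sin t * cddot h e) *: f.

Lemma plane_rot_gen k m t h : (k < 2 ^ r)%N -> (m < 2 ^ r)%N ->
  plane_rot (cdgen R r k) (cdgen R r m) t h = h +
    (-1 + cos t) *: (cdcoord k h *: cdgen R r k + cdcoord m h *: cdgen R r m) +
    sin t *: (cdcoord m h *: cdgen R r k - cdcoord k h *: cdgen R r m).
Proof.
move=> kr mr; rewrite /plane_rot !cddot_gen//.
by apply: cddot_inj => x; rewrite !cddotE; ring.
Qed.

Lemma plane_rot_linear e f t : linear (plane_rot e f t).
Proof.
move=> a x y; rewrite /plane_rot.
apply: cddot_inj => z; rewrite !cddotE; ring.
Qed.

Lemma cddot_plane_rot e f t h :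
  cddot e e = 1 -> cddot f f = 1 -> cddot e f = 0 ->
  cddot (plane_rot e f t h) (plane_rot e f t h) = cddot h h.
Proof.
move=> ee ff ef; rewrite /plane_rot !cddotE.
rewrite (cddotC _ e h) (cddotC _ f h) (cddotC _ f e) ee ff ef.
have : sin t ^+ 2 = 1 - cos t ^+ 2 by rewrite -(cos2Dsin2 t); ring.
move: (cos t) (sin t) => c s cs.
(* The rotation changes the norm by a multiple of sin^2 + cos^2 - 1. *)
transitivity (cddot h h + (s ^+ 2 + c ^+ 2 - 1) *
  (cddot h e ^+ 2 + cddot h f ^+ 2)); first by ring.
by rewrite cs; ring.
Qed.

Lemma plane_rotK e f t : cddot e e = 1 -> cddot f f = 1 -> cddot e f = 0 ->
  cancel (plane_rot e f (- t)) (plane_rot e f t).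
Proof.
move=> ee ff ef h.
have efd x : cddot (plane_rot e f (- t) h) x = cddot h x +
    ((cos t - 1) * cddot h e - sin t * cddot h f) * cddot e x +
     ((cos t - 1) * cddot h f + sin t * cddot h e) * cddot f x.
  by rewrite /plane_rot !cddotE cosN sinN; ring.
rewrite {1}/plane_rot !efd (cddotC _ f e) ee ff ef /plane_rot cosN sinN.
apply: cddot_inj => x; rewrite !cddotE.
have : sin t ^+ 2 = 1 - cos t ^+ 2 by rewrite -(cos2Dsin2 t); ring.
move: (cos t) (sin t) => c s cs.
transitivity (cddot h x + (s ^+ 2 + c ^+ 2 - 1) *
  (cddot h e * cddot e x + cddot h f * cddot f x)); first by ring.
by rewrite cs; ring.
Qed.

End PlaneRotation.

Section Rotations.
Context {R : realType}.

Lemma oct_rotE (k m : 'I_8) (t : R) :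
  oct_rot k m t = plane_rot (cdgen R 3 k) (cdgen R 3 m) t.
Proof.
apply/funext => h; symmetry.
exact: (@plane_rot_gen R 3 k m t h (ltn_ord k) (ltn_ord m)).
Qed.

Lemma oct_gen_orthonormal (i j : 'I_8) :
  cddot (cdgen R 3 i) (cdgen R 3 j) = (i == j)%:R.
Proof.
rewrite (cddot_gen 3 _ j (ltn_ord j)) (cdcoord_gen 3 _ _ (ltn_ord j) (ltn_ord i)).
by rewrite eq_sym.
Qed.

Lemma lorentz_map_oct_rot (k m : 'I_8) (t : R) : (k < m)%N ->
  lorentz_map (fix_infty (oct_rot k m t)).
Proof.
move=> km; have kf : (k == m) = false by rewrite -val_eqE ltn_eqF.
have [kk mm] := (oct_gen_orthonormal k k, oct_gen_orthonormal m m).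
have := oct_gen_orthonormal k m; rewrite kf => km0; rewrite !eqxx in kk mm.
rewrite oct_rotE; apply: (lorentz_map_similarity _ 1) => //.
- exact: plane_rot_linear.
- by move=> w; eexists; apply: plane_rotK.
- by move=> z; rewrite mul1r cddot_plane_rot.
Qed.

Lemma lorentz_map_oct_rots (s : seq ('I_8 * 'I_8 * R)) :
    all (fun p : 'I_8 * 'I_8 * R => (p.1.1 < p.1.2)%N) s ->
  lorentz_map (fix_infty (oct_rots s)).
Proof.
elim: s => [_|p s IH /= /andP[p_lt /IH s_map]].
  by apply: (lorentz_map_similarity _ 1) => // [w|z]; [exists w | rewrite mul1r].
have -> : fix_infty (oct_rots (p :: s)) =
    fix_infty (oct_rot p.1.1 p.1.2 p.2) \o fix_infty (oct_rots s).
  by apply/funext; case.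
exact: (lorentz_map_comp _ _ (lorentz_map_oct_rot _ _ _ p_lt) s_map).
Qed.

Lemma pseudoconformal_lorentz r (f : CDhat R r -> CDhat R r) :
  pseudoconformal f -> lorentz_map f.
Proof.
elim=> {r f} [r c|r|a b ab0|s s_lt|r f g _ Lf _ Lg].
- exact: lorentz_map_shift.
- exact: lorentz_map_inversion.
- exact: lorentz_map_mul.
- exact: lorentz_map_oct_rots.
- exact: lorentz_map_comp.
Qed.

End Rotations.

Theorem theorem35 (R : realType) (r : nat) (hr : r = 2%N \/ r = 3%N)
    (f : CDhat R r -> CDhat R r) (hf : pseudoconformal f)
    (S : set (CDhat R r)) (hS : hypersphere S)
    (z1 z2 : CDhat R r) (hz : symmetrical S z1 z2) :
  hypersphere (f @` S) /\ symmetrical (f @` S) (f z1) (f z2).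
Proof.
have f_map := pseudoconformal_lorentz _ _ hf.
case: r hr f {hf} S hS z1 z2 hz f_map => [[]//|r] _ f S _ z1 z2.
move=> /symmetricalP[s [s0 -> z12]] f_map.
have [s' [s'0 fs fsym]] := lorentz_map_sphere f s f_map s0.
split; first by apply/hypersphereP; exists s'.
by apply/symmetricalP; exists s'; split => //; exact: fsym.
Qed.
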